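(* Every finite distributive lattice is isomorphic to the lattice of stable matchings of some stable matching instance whose graph of stably matchable pairs is subcubic.
   Context: A stable matching instance consists of finite disjoint sets of students and residencies, where each student has a strict linear preference order on a subset of the residencies and each residency has a strict linear preference order on a subset of the students. A matching (set of student–residency pairs, each element in at most one pair) is stable if each of its pairs is mutually acceptable (each member appears in the other's list) and no mutually acceptable pair $(s,r)$ not in it has both $s$ unmatched or preferring $r$ to its partner and $r$ unmatched or preferring $s$ to its partner. The graph of stably matchable pairs of the instance is the bipartite graph whose vertices are all students and residencies and whose edges are the pairs occurring in at least one stable matching. The lattice of stable matchings is the set of stable matchings partially ordered by $M\le M'$ when every student either has the same partner in $M$ and $M'$ or prefers its partner in $M$ to its partner in $M'$; this is a distributive lattice. A graph is subcubic if all vertex degrees are at most three. *)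

(* Defs.v *)
From HB Require Import structures.
From mathcomp Require Import all_boot all_order.

Set Implicit Arguments.
Unset Strict Implicit.
Unset Printing Implicit Defensive.

(* A strict linear order on a subset of a finite type is encoded as a
   duplicate-free list, most preferred element first; the subset is the set of
   members of the list. *)
Record instance := Instance {
  student : finType;
  residency : finType;
  spref : student -> seq residency;
  rpref : residency -> seq student;
  spref_uniq : forall s, uniq (spref s);
  rpref_uniq : forall r, uniq (rpref r)
}.

Definition prefers (T : eqType) (l : seq T) (x y : T) : bool :=
  [&& x \in l, y \in l & index x l < index y l].

Section StableMatching.
Variable I : instance.

Implicit Types (s : student I) (r : residency I).
Implicit Types (M : {set student I * residency I}).

Definition acceptable s r : bool := (r \in spref s) && (s \in rpref r).

Definition is_matching M : bool :=
  [forall p in M, forall q in M, (p.1 == q.1) || (p.2 == q.2) ==> (p == q)].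

Definition student_would_switch M s r : bool :=
  [forall r', (s, r') \notin M] ||
  [exists r', ((s, r') \in M) && prefers (spref s) r r'].

Definition residency_would_switch M s r : bool :=
  [forall s', (s', r) \notin M] ||
  [exists s', ((s', r) \in M) && prefers (rpref r) s s'].

Definition blocking M s r : bool :=
  [&& acceptable s r, (s, r) \notin M,
      student_would_switch M s r & residency_would_switch M s r].

Definition stable M : bool :=
  [&& is_matching M,
      [forall p in M, acceptable p.1 p.2] &
      [forall s, forall r, ~~ blocking M s r]].

Definition stable_matching := {M : {set student I * residency I} | stable M}.

(* A student unmatched in both matchings counts as having the same partner. *)
Definition same_partner M M' s : bool :=
  [forall r, ((s, r) \in M) == ((s, r) \in M')].

Definition prefers_partner M M' s : bool :=
  [exists r, exists r',
     [&& (s, r) \in M, (s, r') \in M' & prefers (spref s) r r']].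

Definition sm_le (A B : stable_matching) : bool :=
  [forall s, same_partner (val A) (val B) s
             || prefers_partner (val A) (val B) s].

Definition stably_matchable s r : bool :=
  [exists M : {set student I * residency I}, stable M && ((s, r) \in M)].

Definition stable_pair_graph : rel (student I + residency I) := fun u v =>
  match u, v with
  | inl s, inr r | inr r, inl s => stably_matchable s r
  | _, _ => false
  end.

End StableMatching.

Definition degree (V : finType) (e : rel V) (v : V) : nat :=
  #|[set w | e v w]|.

Definition subcubic (V : finType) (e : rel V) : bool :=
  [forall v, degree e v <= 3].

(* Main.v *)
Require Import Defs.
From HB Require Import structures.
From mathcomp Require Import all_boot all_order.

(** By Birkhoff's theorem the lattice is the lattice of down-sets of its poset
    [P] of join-prime elements.  Each [p] in [P] gets two students [a_p], [b_p]
    and two residencies [c_p], [d_p], with preferences (best first)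
      [a_p : c_p, (c_q for q < p), d_p]      [b_p : d_p, c_p]
      [c_p : b_p, (a_q for q > p), a_p]      [d_p : a_p, b_p].
    Every last choice ranks its chooser first, so everyone is matched in a
    stable matching.  A pair [a_p c_q] with [q < p] is in no stable matching:
    [d_p] would take [b_p], so [c_p] would take some [a_r] with [r > p], and so
    on upwards forever.  Hence a stable matching contains, for each [p], either
    [a_p c_p] and [b_p d_p], or [a_p d_p] and [b_p c_p].  Let [S] be the set of
    [p] in the second state; the pair [a_p c_q] blocks exactly when [p] is in
    [S] and [q] is not, so stability says that [S] is a down-set. *)

Set Implicit Arguments.
Unset Strict Implicit.
Unset Printing Implicit Defensive.

Import Order.TTheory.

(** * Comparisons with the first and last entries of a preference list *)

Lemma prefers_head (T : eqType) (h x : T) (l : seq T) :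
  prefers (h :: l) x h = false.
Proof. by rewrite /prefers /= eqxx ltn0 !andbF. Qed.

Lemma head_prefers (T : eqType) (h y : T) (l : seq T) :
  y \in l -> y != h -> prefers (h :: l) h y.
Proof.
by move=> yl yh; rewrite /prefers !inE eqxx yl orbT /= eqxx eq_sym (negPf yh).
Qed.

Lemma prefers_last (T : eqType) (t x : T) (l : seq T) :
  x \in l -> t \notin l -> prefers (rcons l t) x t.
Proof.
move=> xl tl; rewrite /prefers !mem_rcons !inE eqxx xl orbT /=.
by rewrite -cats1 !index_cat xl (negPf tl) /= eqxx addn0 index_mem.
Qed.

Lemma bij_of_inj_surj (A : choiceType) (B : eqType) (f : A -> B) :
  injective f -> (forall y, exists x, f x = y) -> bijective f.
Proof.
move=> f_inj f_surj.
have ex y : exists x, f x == y by case: (f_surj y) => x <-; exists x.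
have gK : cancel (fun y => xchoose (ex y)) f.
  by move=> y; apply/eqP; exact: (xchooseP (ex y)).
by exists (fun y => xchoose (ex y)) => // x; apply: f_inj; rewrite gK.
Qed.

(** * Stable matchings in an arbitrary instance *)

Section StableMatchingFacts.
Variables (I : instance) (M : {set student I * residency I}).
Hypothesis M_stable : stable M.

Lemma stable_student_inj s r r' : (s, r) \in M -> (s, r') \in M -> r = r'.
Proof.
case/and3P: M_stable => /forall_inP M_matching _ _ sr sr'.
have /forall_inP/(_ _ sr') := M_matching _ sr.
by rewrite /= eqxx => /eqP[].
Qed.

Lemma stable_residency_inj s s' r : (s, r) \in M -> (s', r) \in M -> s = s'.
Proof.
case/and3P: M_stable => /forall_inP M_matching _ _ sr sr'.
have /forall_inP/(_ _ sr') := M_matching _ sr.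
by rewrite /= eqxx orbT => /eqP[].
Qed.

Lemma stable_acceptable s r : (s, r) \in M -> acceptable s r.
Proof. by case/and3P: M_stable => _ /forall_inP acc _ /acc. Qed.

Lemma stable_not_blocking s r : ~~ blocking M s r.
Proof. by case/and3P: M_stable => _ _ /forallP/(_ s)/forallP/(_ r). Qed.

(** If [r] were free, then [s] would block with it: [s] is either free or matched to something other
    than the head [r] of its list. *)
Lemma first_residency_matched s r l :
  spref s = r :: l -> s \in rpref r -> exists s', (s', r) \in M.
Proof.
move=> sE sr; apply/existsP; apply: contraT => /existsPn r_free.
case/negP: (stable_not_blocking s r); apply/and4P; split.
- by rewrite /acceptable sE mem_head.
- exact: r_free.
- case: (boolP [forall r', (s, r') \notin M]) => [s_free|].
    by rewrite /student_would_switch s_free.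
  case/forallPn=> r' /negPn sr'; apply/orP; right; apply/existsP; exists r'.
  have := stable_acceptable sr'; rewrite /acceptable sE inE => /andP[r'l _].
  have r'r : r' != r by apply: contraL sr' => /eqP->.
  by rewrite sr' head_prefers //; rewrite (negPf r'r) in r'l.
- by apply/orP; left; apply/forallP.
Qed.

Lemma first_student_matched s r l :
  rpref r = s :: l -> r \in spref s -> exists r', (s, r') \in M.
Proof.
move=> rE rs; apply/existsP; apply: contraT => /existsPn s_free.
case/negP: (stable_not_blocking s r); apply/and4P; split.
- by rewrite /acceptable rE mem_head rs.
- exact: s_free.
- by apply/orP; left; apply/forallP.
- case: (boolP [forall s', (s', r) \notin M]) => [r_free|].
    by rewrite /residency_would_switch r_free.
  case/forallPn=> s' /negPn s'r; apply/orP; right; apply/existsP; exists s'.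
  have := stable_acceptable s'r; rewrite /acceptable rE inE => /andP[_ s'l].
  have s's : s' != s by apply: contraL s'r => /eqP->.
  by rewrite s'r head_prefers //; rewrite (negPf s's) in s'l.
Qed.

End StableMatchingFacts.

(** * The instance attached to a finite strict order *)

Section PosetInstance.
Variables (P : finType) (lt : rel P).
Hypotheses (lt_irr : irreflexive lt) (lt_trans : transitive lt).

(* As students, [(p, false)] and [(p, true)] are [a_p] and [b_p]; as
   residencies they are [c_p] and [d_p]. *)
Definition poset_spref (s : P * bool) : seq (P * bool) :=
  let: (p, b) := s in
  (p, b) :: rcons (if b then [::] else [seq (q, false) | q <- enum P & lt q p])
                  (p, ~~ b).

Definition poset_rpref (r : P * bool) : seq (P * bool) :=
  let: (p, b) := r in
  (p, ~~ b) :: rcons (if b then [::] else [seq (q, false) | q <- enum P & lt p q])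
                     (p, b).

Lemma mem_middle (D : pred P) (q : P) (b : bool) :
  ((q, b) \in [seq (r, false) | r <- enum P & D r]) = ~~ b && D q.
Proof.
apply/mapP/andP => [[r]|[/negPf-> Dq]].
  by rewrite mem_filter => /andP[Dr _] [-> ->].
by exists q; rewrite // mem_filter Dq mem_enum.
Qed.

Lemma uniq_middle (D : pred P) : uniq [seq (r, false) | r <- enum P & D r].
Proof. by rewrite map_inj_uniq => [|x y []]//; apply/filter_uniq/enum_uniq. Qed.

Lemma poset_spref_uniq s : uniq (poset_spref s).
Proof.
case: s => p [] /=; first by rewrite inE xpair_eqE eqxx.
by rewrite mem_rcons inE rcons_uniq uniq_middle !mem_middle xpair_eqE lt_irr !andbF.
Qed.

Lemma poset_rpref_uniq r : uniq (poset_rpref r).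
Proof.
case: r => p [] /=; first by rewrite inE xpair_eqE eqxx.
by rewrite mem_rcons inE rcons_uniq uniq_middle !mem_middle xpair_eqE lt_irr !andbF.
Qed.

Definition poset_instance : instance :=
  Instance poset_spref_uniq poset_rpref_uniq.

Implicit Types (S T : {set P}).

(** The middle parts of the two families of lists mirror each other, so being listed on one side
    forces being listed on the other. *)
Lemma poset_acceptable p b q c :
  @acceptable poset_instance (p, b) (q, c)
  = (p == q) || [&& ~~ b, ~~ c & lt q p].
Proof.
rewrite /acceptable /= !inE !mem_rcons !inE !xpair_eqE [q == p]eq_sym.
case: eqVneq => [->|_]; first by case: b; case: c.
by case: b; case: c; rewrite /= ?mem_middle // andbb.
Qed.

Definition down_set S := forall p q, lt p q -> q \in S -> p \in S.

(** The exclusive or encodes the two states: equal bits pair [a_p c_p] and [b_p d_p], opposite bits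
    pair [a_p d_p] and [b_p c_p]. *)
Definition matching_of S : {set student poset_instance * residency poset_instance} :=
  [set e | (e.1.1 == e.2.1) && (e.1.2 (+) e.2.2 == (e.1.1 \in S))].

Lemma in_matching_of S p b q c :
  (((p, b), (q, c)) \in matching_of S) = (p == q) && (b (+) c == (p \in S)).
Proof. by rewrite inE. Qed.

Lemma matching_of_studentE S p b (r : P * bool) :
  (((p, b), r) \in matching_of S) = (r == (p, b (+) (p \in S))).
Proof.
case: r => q c; rewrite in_matching_of xpair_eqE eq_sym.
by case: b; case: c; case: (p \in S).
Qed.

Lemma matching_of_residencyE S q c (s : P * bool) :
  ((s, (q, c)) \in matching_of S) = (s == (q, c (+) (q \in S))).
Proof.
case: s => p b; rewrite in_matching_of xpair_eqE.
by case: eqVneq => [->|//]; case: b; case: c; case: (q \in S).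
Qed.

(** For [p] outside [S], both students at [p] already hold their first choice. *)
Lemma student_switch_matching_of S p b (r : P * bool) :
  student_would_switch (matching_of S) (p, b) r -> p \in S.
Proof.
case/orP=> [/forallP/(_ (p, b (+) (p \in S)))|/existsP[r']].
  by rewrite matching_of_studentE eqxx.
rewrite matching_of_studentE => /andP[/eqP->].
by case: (p \in S) => //; rewrite addbF [spref _]/= prefers_head.
Qed.

(** Dually, for [q] in [S] both residencies at [q] already hold their first choice. *)
Lemma residency_switch_matching_of S (s : P * bool) q c :
  residency_would_switch (matching_of S) s (q, c) -> q \notin S.
Proof.
case/orP=> [/forallP/(_ (q, c (+) (q \in S)))|/existsP[s']].
  by rewrite matching_of_residencyE eqxx.
rewrite matching_of_residencyE => /andP[/eqP->].
by case: (q \in S) => //; rewrite addbT [rpref _]/= prefers_head.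
Qed.

Lemma stable_matching_of S : down_set S -> stable (matching_of S).
Proof.
move=> S_down; apply/and3P; split.
- apply/forall_inP => -[[p b] [q c]]; rewrite in_matching_of => /andP[/eqP<- bc].
  apply/forall_inP => -[[p' b'] [q' c']]; rewrite in_matching_of => /andP[/eqP<- bc'].
  apply/implyP; rewrite /= !xpair_eqE -andb_orr => /andP[/eqP pp'].
  move: bc bc'; rewrite -pp' eqxx.
  by case: b b' c c' (p \in S) => [] [] [] [] [].
- apply/forall_inP => -[[p b] [q c]]; rewrite in_matching_of => /andP[pq _].
  by rewrite poset_acceptable pq.
apply/forallP => -[p b]; apply/forallP => -[q c]; apply/negP => /and4P[acc _].
move=> /student_switch_matching_of pS /residency_switch_matching_of qS.
move: acc; rewrite poset_acceptable => /orP[/eqP pq|/and3P[_ _ qp]].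
  by rewrite -pq pS in qS.
by rewrite (S_down _ _ qp pS) in qS.
Qed.

(** * Every stable matching comes from a down-set *)

Section Classification.
Variable M : {set student poset_instance * residency poset_instance}.
Hypothesis M_stable : stable M.

Lemma poset_student_matched (s : P * bool) : exists r, (s, r) \in M.
Proof.
case: s => p b.
apply: (@first_student_matched _ _ M_stable (p, b) (p, ~~ b)).
  by rewrite /= negbK.
by rewrite /= inE mem_rcons mem_head orbT.
Qed.

Lemma poset_residency_matched (r : P * bool) : exists s, (s, r) \in M.
Proof.
case: r => p b.
apply: (@first_residency_matched _ _ M_stable (p, b) (p, b)); first by [].
by rewrite /= inE mem_rcons mem_head orbT.
Qed.

Lemma poset_stable_level p b q c : ((p, b), (q, c)) \in M -> p = q.
Proof.
(* Induction on the number of elements above [p] turns the endless upward chain into a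
   contradiction. *)
have [n] := ubnP #|[set r | lt p r]|.
elim: n p b q c => // n IHn p b q c le_n pqM.
have := stable_acceptable M_stable pqM.
rewrite poset_acceptable; case: eqVneq => //= pq /and3P[/negPf b0 /negPf c0 qp].
rewrite {b}b0 {c}c0 in pqM.
have [[p1 b1] dM] := poset_residency_matched (p, true).
have := stable_acceptable M_stable dM; rewrite poset_acceptable andbF orbF.
move=> /eqP p1E; rewrite {p1}p1E in dM; case: b1 dM => dM; last first.
  by have [pq'] := stable_student_inj M_stable dM pqM; rewrite pq' eqxx in pq.
have [[r b2] cM] := poset_residency_matched (p, false).
have := stable_acceptable M_stable cM; rewrite poset_acceptable.
case: eqVneq => [rp _|rp /= /andP[_ pr]].
  rewrite {r}rp in cM; case: b2 cM => cM.
    by have := stable_student_inj M_stable dM cM.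
  by have [pq'] := stable_student_inj M_stable cM pqM; rewrite pq' eqxx in pq.
(* Now [c_p] holds a student at some [r] above [p], and fewer elements lie above [r]. *)
suff rp' : r = p by rewrite rp' eqxx in rp.
apply: (IHn _ _ _ _ _ cM); rewrite -ltnS; apply: leq_trans le_n.
rewrite ltnS; apply: proper_card; apply/properP; split.
  by apply/subsetP => x; rewrite !inE; apply: lt_trans.
by exists r; rewrite !inE // lt_irr.
Qed.

Definition switched : {set P} := [set p | ((p, false), (p, true)) \in M].

Lemma poset_stableE : M = matching_of switched.
Proof.
have a_partner p : ((p, false), (p, p \in switched)) \in M.
  have [[q c] pM] := poset_student_matched (p, false).
  have pq := poset_stable_level pM; rewrite -pq {q pq} in pM.
  have [pS|pS] := boolP (p \in switched); first by rewrite in_set in pS.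
  by case: c pM => // pM; rewrite in_set pM in pS.
(* [b_p] gets whichever of [c_p], [d_p] the student [a_p] leaves. *)
have b_partner p : ((p, true), (p, p \notin switched)) \in M.
  have [[q c] pM] := poset_student_matched (p, true).
  have pq := poset_stable_level pM; rewrite -pq {q pq} in pM.
  have [cE|cE] := eqVneq c (p \notin switched); first by rewrite -cE.
  have {}cE : c = (p \in switched) by case: c (p \in switched) cE {pM} => [] [].
  by rewrite cE in pM; have := stable_residency_inj M_stable pM (a_partner p).
have partner p b : ((p, b), (p, b (+) (p \in switched))) \in M.
  by case: b; [exact: b_partner|exact: a_partner].
apply/setP => -[[p b] r]; rewrite matching_of_studentE.
apply/idP/eqP => [prM|-> //].
exact: (stable_student_inj M_stable prM (partner p b)).
Qed.

(** Otherwise [a_p] and [c_q] block: [a_p] is left with its last choice [d_p], and [c_q] with its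
    last choice [a_q]. *)
Lemma switched_down : down_set switched.
Proof.
move=> q p qp pS; apply: contraT => qS.
have qp' : q != p by apply: contraTneq qp => ->; rewrite lt_irr.
have := stable_not_blocking M_stable (p, false) (q, false).
rewrite /blocking poset_acceptable qp orbT /= {1}poset_stableE in_matching_of.
rewrite [p == q]eq_sym (negPf qp') /= => /negP[]; apply/andP; split; apply/orP; right.
- apply/existsP; exists (p, true).
  rewrite {1}poset_stableE matching_of_studentE pS eqxx [spref _]/=.
  rewrite -rcons_cons prefers_last // !inE ?xpair_eqE ?mem_middle ?qp ?orbT //.
  by rewrite andbF.
- apply/existsP; exists (q, false).
  rewrite {1}poset_stableE matching_of_residencyE (negPf qS) eqxx [rpref _]/=.
  rewrite -rcons_cons prefers_last // !inE ?xpair_eqE ?mem_middle ?qp ?orbT //.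
  by rewrite lt_irr !andbF.
Qed.

End Classification.

(** * Order and degrees *)

Lemma matching_of_inj : injective matching_of.
Proof.
move=> S T /setP eqST; apply/setP => p.
have := eqST ((p, false), (p, true)).
by rewrite !in_matching_of eqxx /=; case: (p \in S); case: (p \in T).
Qed.

(** Switching [p] moves both of its students from first to last choice, so a smaller set is better
    for every student, matching the direction of [sm_le]. *)
Lemma matching_of_le S T (A B : stable_matching poset_instance) :
  val A = matching_of S -> val B = matching_of T -> sm_le A B = (S \subset T).
Proof.
rewrite /sm_le => -> ->; apply/forallP/subsetP => [leST p pS|leST [p b]].
  case/orP: (leST (p, false)) => [/forallP/(_ (p, true))|/existsP[r /existsP[r']]].
    by rewrite !in_matching_of eqxx pS; case: (p \in T).
  rewrite !matching_of_studentE => /and3P[_ /eqP->].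
  by case: (p \in T) => //; rewrite [spref _]/= prefers_head.
have [pST|pST] := eqVneq (p \in S) (p \in T).
  apply/orP; left; apply/forallP => r.
  by rewrite /= !matching_of_studentE pST.
have pS : p \notin S by apply: contra pST => pS; rewrite pS (leST _ pS).
have pT : p \in T by move: pST; rewrite (negPf pS); case: (p \in T).
apply/orP; right; apply/existsP; exists (p, b); apply/existsP; exists (p, ~~ b).
rewrite !matching_of_studentE (negPf pS) pT addbF addbT !eqxx [spref _]/=.
rewrite head_prefers ?mem_rcons ?mem_head //.
by rewrite xpair_eqE eqxx; case: b.
Qed.

Lemma stably_matchable_level (s r : P * bool) :
  @stably_matchable poset_instance s r -> s.1 = r.1.
Proof.
case: s r => [p b] [q c] /existsP[M /andP[M_stable]].
exact: poset_stable_level.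
Qed.

Lemma poset_instance_subcubic : subcubic (@stable_pair_graph poset_instance).
Proof.
apply/forallP => v; rewrite /degree.
(* Stable pairs stay within one [p], so every degree is in fact at most two. *)
pose nbrs : seq (student poset_instance + residency poset_instance) :=
  match v with
  | inl s => [:: inr (s.1, true); inr (s.1, false)]
  | inr r => [:: inl (r.1, true); inl (r.1, false)]
  end.
have nbrs_size : size nbrs <= 3 by rewrite {}/nbrs; case: v.
apply: leq_trans nbrs_size; apply: leq_trans (card_size nbrs).
apply/subset_leq_card/subsetP => w; rewrite inE {}/nbrs.
case: v w => [s|r] [s'|r'] //= /stably_matchable_level e; rewrite !inE.
  by case: r' e => q [] /= ->; rewrite eqxx ?orbT.
by case: s' e => q [] /= ->; rewrite eqxx ?orbT.
Qed.

End PosetInstance.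

(** * Birkhoff's representation by join-prime elements *)

Section Birkhoff.
Variables (d : Order.disp_t) (L : finDistrLatticeType d).
Local Open Scope order_scope.

(** The first conjunct excludes the bottom element without naming it. *)
Definition join_prime (p : L) : bool :=
  ~~ [forall y, p <= y] &&
  [forall x, forall y, (p <= x `|` y) ==> (p <= x) || (p <= y)].

(** Induction on the size of the down-set of [x]. If [x] is not join-prime, distributivity splits it
    into a join of two strictly smaller elements, and one of them is still not below [y]. *)
Lemma join_prime_separates (x y : L) :
  ~~ (x <= y) -> exists p, [&& join_prime p, p <= x & ~~ (p <= y)].
Proof.
have [n] := ubnP #|[set z | z <= x]|.
elim: n x => // n IHn x le_n xy.
have [x_prime|] := boolP (join_prime x); first by exists x; rewrite x_prime lexx.
have below z : z < x -> ~~ (z <= y) ->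
    exists p, [&& join_prime p, p <= x & ~~ (p <= y)].
  move=> zx zy; have [|p /and3P[pp pz py]] := IHn z _ zy.
    rewrite -ltnS; apply: leq_trans le_n; rewrite ltnS; apply: proper_card.
    apply/properP; split; last by exists x; rewrite !inE ?lexx // lt_geF.
    by apply/subsetP => t; rewrite !inE => /le_trans; apply; apply: ltW.
  by exists p; rewrite pp py (le_trans pz (ltW zx)).
rewrite negb_and negbK => /orP[/forallP/(_ y) xy'|]; first by rewrite xy' in xy.
case/forallPn=> u /forallPn[v]; rewrite negb_imply negb_or.
case/and3P=> xuv xu xv.
have xE : x = (x `&` u) `|` (x `&` v) by rewrite -meetUr; apply/esym/meet_idPl.
have [uy|uy] := boolP (x `&` u <= y); last first.
  by apply: (below _ _ uy); rewrite lt_neqAle leIl andbT eq_meetl.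
have [vy|vy] := boolP (x `&` v <= y); last first.
  by apply: (below _ _ vy); rewrite lt_neqAle leIl andbT eq_meetl.
by rewrite xE leUx uy vy in xy.
Qed.

Definition prime_below (x : L) : {set {p : L | join_prime p}} :=
  [set p | val p <= x].

Lemma prime_below_subset x y : (prime_below x \subset prime_below y) = (x <= y).
Proof.
apply/subsetP/idP => [sub|xy p]; last by rewrite !inE => /le_trans; apply.
apply: contraT => /join_prime_separates[p /and3P[pp px /negP[]]].
by have := sub (exist _ p pp); rewrite !inE; apply.
Qed.

Lemma prime_below_inj : injective prime_below.
Proof. by move=> x y e; apply/le_anti; rewrite -!prime_below_subset e subxx. Qed.

Lemma prime_below_down x :
  down_set (fun p q : {p : L | join_prime p} => val p < val q) (prime_below x).
Proof. by move=> p q pq; rewrite !inE => /(lt_le_trans pq)/ltW. Qed.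

Lemma finite_lattice_bottom : (0 < #|L|)%N -> exists b : L, forall x, b <= x.
Proof.
case/card_gt0P=> x0 _; exists (foldr Order.meet x0 (enum L)) => x.
have : x \in enum L by rewrite mem_enum.
elim: (enum L) => //= y l IHl; rewrite inE => /orP[/eqP->|/IHl]; first exact: leIl.
exact: leIxr.
Qed.

(** The preimage is the join of [S]. A join-prime below this join is below a member of [S], hence in
    [S]; the starting value [b] of the fold cannot absorb it, since a join-prime is not the
    bottom. *)
Lemma prime_below_surj (S : {set {p : L | join_prime p}}) :
  (0 < #|L|)%N ->
  down_set (fun p q : {p : L | join_prime p} => val p < val q) S ->
  exists x, prime_below x = S.
Proof.
case/finite_lattice_bottom=> b b_min S_down.
pose x := foldr (fun p : {p : L | join_prime p} => Order.join (val p)) b (enum S).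
exists x; apply/setP => q; rewrite inE; apply/idP/idP => [qx|qS].
  have [p pS qp] : exists2 p, p \in S & val q <= val p.
    case/andP: (valP q) => q_nbot /forallP q_prime.
    have: {subset enum S <= S} by move=> p; rewrite mem_enum.
    move: qx; rewrite {}/x; elim: (enum S) => [|p l IHl] /= qx sub.
      case/negP: q_nbot; apply/forallP => y.
      exact: le_trans qx (b_min y).
    have /forallP/(_ _)/implyP/(_ qx)/orP[qp|ql] := q_prime (val p).
      by exists p => //; apply: sub; rewrite mem_head.
    by apply: IHl => // t tl; apply: sub; rewrite inE tl orbT.
  have [/val_inj-> //|qp'] := eqVneq (val q) (val p).
  by apply: S_down pS; rewrite lt_neqAle qp'.
have : q \in enum S by rewrite mem_enum.
rewrite /x; elim: (enum S) => //= p l IHl; rewrite inE => /orP[/eqP->|/IHl ql].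
  exact: leUl.
exact: lexUr.
Qed.

End Birkhoff.

Theorem theorem12 (d : Order.disp_t) (L : finDistrLatticeType d)
    (L_nonempty : 0 < #|L|) :
  exists I : instance,
    subcubic (@stable_pair_graph I) /\
    exists f : L -> stable_matching I,
      bijective f /\ {mono f : x y / (x <= y)%O >-> sm_le x y}.
Proof.
pose lt := fun p q : {p : L | join_prime p} => (val p < val q)%O.
have lt_irr : irreflexive lt by move=> p; exact: ltxx.
have lt_tr : transitive lt by move=> q p r; exact: lt_trans.
exists (poset_instance lt_irr); split; first exact: poset_instance_subcubic.
pose f x : stable_matching (poset_instance lt_irr) :=
  exist (@stable _) _ (stable_matching_of lt_irr (@prime_below_down _ _ x)).
exists f; split; last first.
  move=> x y; rewrite -prime_below_subset.
  exact: (matching_of_le (erefl (val (f x))) (erefl (val (f y)))).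
apply: bij_of_inj_surj => [x y|[M M_stable]].
  by case=> /matching_of_inj/prime_below_inj.
(* Surjectivity: the switched set of [M] is a down-set of join-primes, hence comes from some [x]. *)
have [x xE] := prime_below_surj L_nonempty (@switched_down _ _ lt_irr lt_tr M M_stable).
exists x; apply: val_inj => /=.
by rewrite [RHS](poset_stableE lt_tr M_stable) xE.
Qed.
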